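(* Let $X$ be a $\pi$-semiregular topological space with $\pi w(X)\ge\aleph_0$. Then there exists a compact Hausdorff zero-dimensional space $Y$ with $w(Y)=\pi w(X)$ for which the Boolean algebras $RC(X)$ and $RC(Y)$ are isomorphic.
   Context: $RC(X)$ is the Boolean algebra of regular closed subsets of $X$ ($F=\mathrm{cl}(\mathrm{int}(F))$), with $F\vee G=F\cup G$, $F\wedge G=\mathrm{cl}(\mathrm{int}(F\cap G))$, $F^*=\mathrm{cl}(X\setminus F)$. $RO(X)$ is the family of regular open subsets of $X$ ($U=\mathrm{int}(\mathrm{cl}(U))$). A family $\mathcal{B}$ of open subsets of $X$ is a $\pi$-base of $X$ if for each non-empty open $U\subseteq X$ there is a non-empty $V\in\mathcal{B}$ with $V\subseteq U$; $\pi w(X)=\min\{|\mathcal{B}|\mid\mathcal{B}\text{ is a }\pi\text{-base of }X\}$. A space $X$ is $\pi$-semiregular if $RO(X)$ is a $\pi$-base of $X$. $w(Y)$ is the weight of $Y$; zero-dimensional means having a base of clopen sets. *)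

(* Defs.v *)
From HB Require Import structures.
From mathcomp Require Import all_boot all_order.
From mathcomp Require Import all_classical topology.

Set Implicit Arguments.
Unset Strict Implicit.
Unset Printing Implicit Defensive.

Import Order.TTheory.
Local Open Scope classical_set_scope.
Local Open Scope card_scope.

(* A member of F of least cardinality. Cardinal numbers are represented by    *)
(* such sets, compared with #<= and #=.                                       *)
Definition least_card T (F : set (set T)) (A : set T) :=
  F A /\ forall B, F B -> A #<= B.

Lemma least_card_exists T (F : set (set T)) :
  F !=set0 -> least_card F !=set0.
Proof.
case=> A0 FA0.
pose P (S : set (set T -> T)) :=
  (forall s A, S s -> F A -> A (s A)) /\
  (forall s s' A, S s -> S s' -> F A -> s A = s' A -> s = s').
have [S [[SF Sinj] Smax]] : exists S, P S /\ forall S', S `<` S' -> ~ P S'.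
  apply: Zorn_bigcup => C CP Ctot; split.
    by move=> s A [S /CP[+ _] Ss]; apply.
  move=> s s' A [S CS Ss] [S' CS' S's'].
  have [SS'|S'S] := Ctot _ _ CS CS'.
    by have [_] := CP _ CS'; apply=> //; exact: SS'.
  by have [_] := CP _ CS; apply=> //; exact: S'S.
have [[A [FA Asurj]]|noA] :=
    pselect (exists A, F A /\ forall a, A a -> exists2 s, S s & s A = a).
  exists A; split=> // B FB.
  have /choice[s0 sP] : forall a, exists s : set T -> T, A a -> S s /\ s A = a.
    move=> a; have [/Asurj[s Ss sa]|nAa] := pselect (A a); first by exists s.
    by exists (fun=> a).
  have /injfunPex[g] : exists2 f : T -> T, set_fun A B f & set_inj A f.
    exists (fun a => s0 a B).
      by move=> a /sP[Ss _]; exact: (SF _ B Ss).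
    move=> a b /set_mem /sP[Sa {2}<-] /set_mem /sP[Sb {2}<-] e.
    by rewrite (Sinj _ _ _ Sa Sb FB e).
  exact: inj_card_le g.
have miss A : F A -> exists a, A a /\ forall s, S s -> s A <> a.
  move=> FA; apply: contrapT => nex; apply: noA; exists A; split=> // a Aa.
  apply: contrapT => ns; apply: nex; exists a; split=> // s Ss sa.
  by apply: ns; exists s.
have [t0 _] := miss _ FA0.
have /choice[s0 s0P] :
    forall A, exists a, F A -> A a /\ forall s, S s -> s A <> a.
  move=> A; have [/miss[a aP]|nFA] := pselect (F A); first by exists a.
  by exists t0.
exfalso; apply: (Smax (S `|` [set s0])).
  split; first exact: subsetUl.
  move=> /(_ s0 (or_intror erefl)) Ss0.
  by have [_ /(_ _ Ss0)] := s0P _ FA0.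
split.
  move=> s A [Ss|->] FA; first exact: (SF _ _ Ss).
  by have [] := s0P _ FA.
move=> s s' A [Ss|->] [Ss'|->] FA //.
- exact: (Sinj _ _ A).
- by have [_ /(_ _ Ss)] := s0P _ FA.
- by have [_ /(_ _ Ss') h] := s0P _ FA => e; case: h.
Qed.

Section weights.
Variable X : topologicalType.

Definition pi_base (B : set (set X)) :=
  B `<=` open /\
  forall U : set X, open U -> U !=set0 ->
    exists V, [/\ B V, V !=set0 & V `<=` U].

Definition pi_semiregular := pi_base [set U : set X | regopen U].

(* The cardinals pi w(X) and w(X), each represented by a family of least      *)
(* cardinality; the default set0 is never used, see the two lemmas below.     *)
Definition pi_weight : set (set X) := xget set0 (least_card pi_base).

Definition weight : set (set X) := xget set0 (least_card (@basis X)).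

Lemma pi_weightP : least_card pi_base pi_weight.
Proof.
apply: xgetPex; apply: least_card_exists.
by exists open; split=> [A //|U oU U0]; exists U; split.
Qed.

Lemma weightP : least_card (@basis X) weight.
Proof.
apply: xgetPex; apply: least_card_exists; exists open; split=> [A //|x A].
by rewrite nbhsE => -[B [oB Bx] BA]; exists B.
Qed.

(* The library's zero_dimensional only asks that distinct points be separated *)
(* by clopen sets; this is the existence of a base of clopen sets.            *)
Definition has_clopen_base := exists2 B, @basis X B & B `<=` clopen.

End weights.

Arguments pi_weight : clear implicits.
Arguments weight : clear implicits.

Section rc_sets.
Variable X : topologicalType.
Implicit Types A B C W : set X.

Lemma regclosed_closed A : regclosed A -> closed A.
Proof. by move=> <-; exact: closed_closure. Qed.

Lemma regclosed0 : regclosed (@set0 X).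
Proof. by rewrite /regclosed interior0 closure0. Qed.

Lemma regclosedT : regclosed [set: X].
Proof. by rewrite /regclosed interiorT closureT. Qed.

Lemma regclosedU A B : regclosed A -> regclosed B -> regclosed (A `|` B).
Proof.
move=> rA rB; have cAB : closed (A `|` B).
  by apply: closedU; exact: regclosed_closed.
apply/seteqP; split.
  rewrite [X in _ `<=` X](closure_id _).1//.
  by apply: closureS; exact: interior_subset.
rewrite -{1}rA -{1}rB -closureU.
by apply: closureS; exact: interiorU.
Qed.

Lemma regclosed_closure_interior A : regclosed (closure A°).
Proof. exact: closure_interior_idem. Qed.

Lemma regclosed_closureC A : regclosed A -> regclosed (closure (~` A)).
Proof.
by move=> /regclosed_closed cA; apply: closure_open_regclosed; rewrite openC.
Qed.

Lemma open_setI_closure W A : open W -> W `&` closure A `<=` closure (W `&` A).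
Proof.
move=> oW x [Wx clA] N Nx.
have [|y [Ay [Wy Ny]]] := clA (W `&` N); last by exists y.
by apply: filterI => //; exact: open_nbhs_nbhs.
Qed.

Lemma regclosed_subI A B C : regclosed C -> C `<=` A -> C `<=` B ->
  C `<=` closure (A `&` B)°.
Proof.
move=> rC CA CB; rewrite -{1}rC; apply: closureS; apply: interiorS.
by rewrite subsetI.
Qed.

Lemma regclosed_closure_interior_sub A B :
  closed B -> A `<=` B -> closure A° `<=` B.
Proof.
move=> cB AB; rewrite (closure_id B).1//; apply: closureS.
exact: subset_trans (@interior_subset _ _) AB.
Qed.

Lemma regclosedIUl A B C : regclosed A -> regclosed B ->
  closure ((A `|` B) `&` C)° `<=` closure (A `&` C)° `|` closure (B `&` C)°.
Proof.
move=> rA rB; set W := (_ `&` _)°.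
have oW : open W by exact: open_interior.
have WABC : W `<=` (A `|` B) `&` C by exact: interior_subset.
have key D : closure (W `&` D°) `<=` closure (D `&` C)°.
  apply: closureS; rewrite -[X in X `<=` _](interior_id _).1.
    by apply: interiorS => x [/WABC[_ Cx] /interior_subset Dx].
  by apply: openI => //; exact: open_interior.
apply: (subset_trans _ (setUSS (key A) (key B))); rewrite -closureU -setIUr.
have cl D : closure (closure D) = closure D :> set X.
  by rewrite -(closure_id _).1//; exact: closed_closure.
rewrite -[X in _ `<=` X]cl; apply: closureS => x Wx; apply: open_setI_closure => //; split=> //.
by rewrite closureU rA rB; have [] := WABC _ Wx.
Qed.

End rc_sets.

(* The Boolean algebra of regular closed sets, ordered by inclusion.          *)
Record RC (X : topologicalType) := MkRC {
  rc_set :> set X;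
  rc_subproof : `[< regclosed rc_set >] }.

HB.instance Definition _ (X : topologicalType) := [isSub for @rc_set X].
HB.instance Definition _ (X : topologicalType) := [Choice of RC X by <:].
HB.instance Definition _ (X : topologicalType) :=
  [SubChoice_isSubPOrder of RC X by <: with set_display].

Section rc_algebra.
Variable X : topologicalType.
Implicit Types F G H : RC X.

Definition rc_of (A : set X) (rA : regclosed A) : RC X := MkRC (asboolT rA).

Lemma rcP F : regclosed F.
Proof. by have /asboolP := rc_subproof F. Qed.

Lemma rc_closed F : closed F.
Proof. by apply: regclosed_closed; exact: rcP. Qed.

Lemma rc_inj F G : F = G :> set X -> F = G.
Proof. by move=> e; exact/val_inj. Qed.

Lemma rc_leP F G : reflect (F `<=` G) (F <= G)%O.
Proof. by rewrite leEsub; exact: subsetPset. Qed.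

Definition rc_join F G : RC X := rc_of (regclosedU (rcP F) (rcP G)).
Definition rc_meet F G : RC X := rc_of (regclosed_closure_interior (F `&` G)).
Definition rc_compl F : RC X := rc_of (regclosed_closureC (rcP F)).
Definition rc_bot : RC X := rc_of (@regclosed0 X).
Definition rc_top : RC X := rc_of (@regclosedT X).

Lemma rc_meetP F G H : (F <= rc_meet G H)%O = (F <= G)%O && (F <= H)%O.
Proof.
apply/rc_leP/andP => [FGH|[/rc_leP FG /rc_leP FH]]; last first.
  by apply: regclosed_subI => //; exact: rcP.
have sub (K : RC X) : G `&` H `<=` K -> (F <= K)%O.
  move=> GHK; apply/rc_leP/(subset_trans FGH).
  by apply: regclosed_closure_interior_sub => //; exact: rc_closed.
by split; apply: sub => x [].
Qed.

Lemma rc_joinP F G H : (rc_join F G <= H)%O = (F <= H)%O && (G <= H)%O.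
Proof.
apply/rc_leP/andP => [|[/rc_leP FH /rc_leP GH]]; last by rewrite /= subUset.
by rewrite /= subUset => -[? ?]; split; apply/rc_leP.
Qed.

HB.instance Definition _ :=
  Order.POrder_MeetJoin_isLattice.Build set_display (RC X) rc_meetP rc_joinP.

Lemma rc_meetUl : @left_distributive (RC X) (RC X) Order.meet Order.join.
Proof.
move=> F G H; apply/le_anti/andP; split.
  by apply/rc_leP/regclosedIUl; exact: rcP.
by rewrite leUx !leI2 ?leUl ?leUr.
Qed.

HB.instance Definition _ :=
  Order.Lattice_Meet_isDistrLattice.Build set_display (RC X) rc_meetUl.

Lemma rc_le0x F : (rc_bot <= F)%O.
Proof. by apply/rc_leP; exact: sub0set. Qed.

Lemma rc_lex1 F : (F <= rc_top)%O.
Proof. by apply/rc_leP; exact: subsetT. Qed.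

HB.instance Definition _ := Order.hasBottom.Build set_display (RC X) rc_le0x.
HB.instance Definition _ := Order.hasTop.Build set_display (RC X) rc_lex1.

Lemma rc_joinxC F : (F `|` rc_compl F)%O = \top%O.
Proof.
apply: rc_inj; apply/seteqP; split=> // x _ /=.
by have [Fx|nFx] := pselect (rc_set F x); [left|right; exact: subset_closure].
Qed.

Lemma rc_meetxC F : (F `&` rc_compl F)%O = \bot%O.
Proof.
apply: rc_inj; rewrite /= closure_setC interiorI interiorC rcP.
suff -> : (F : set X)° `&` ~` F = set0 by exact: closure0.
by apply/seteqP; split=> // x [/interior_subset].
Qed.

HB.instance Definition _ :=
  Order.TBDistrLattice_hasComplement.Build set_display (RC X)
    rc_joinxC rc_meetxC.

Lemma rc_meetE F G : (F `&` G)%O = closure ((F : set X) `&` (G : set X))° :> set X.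
Proof. by []. Qed.

Lemma rc_joinE F G : (F `|` G)%O = (F : set X) `|` (G : set X) :> set X.
Proof. by []. Qed.

Lemma rc_complE F : (~` F)%O = closure (~` (F : set X)) :> set X.
Proof. by []. Qed.

Lemma rc_botE : (\bot%O : RC X) = set0 :> set X.
Proof. by []. Qed.

Lemma rc_topE : (\top%O : RC X) = setT :> set X.
Proof. by []. Qed.

End rc_algebra.

Definition boolean_isomorphic d d'
    (A : ctbDistrLatticeType d) (B : ctbDistrLatticeType d') :=
  exists2 f : A -> B, bijective f &
    [/\ f \bot%O = \bot%O, f \top%O = \top%O,
        {morph f : x y / (x `&` y)%O}, {morph f : x y / (x `|` y)%O} &
        {morph f : x / (~` x)%O}].

(* Main.v *)
(* The sets cl (int V), V in a pi-base P of least size, are dense in RC(X).   *)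
(* Since P is infinite, they generate a subalgebra A of size at most |P|, by  *)
(* Hessenberg's theorem k * k = k. Take for Y the Stone space of A: the clopen*)
(* sets cell a (a in A) form a base, so w(Y) <= |A| <= pi w(X). As A is dense *)
(* in the complete algebra RC(X), sending F to the closure of the union of the*)
(* cell a, a <= F, is an order isomorphism from RC(X) onto RC(Y). Conversely, *)
(* this isomorphism carries a base of Y back to a pi-base of X, because X is  *)
(* pi-semiregular, and thus pi w(X) <= w(Y).                                  *)
Require Import Defs.
From HB Require Import structures.
From mathcomp Require Import all_boot all_order.
From mathcomp Require Import all_classical topology.
Set Implicit Arguments.
Unset Strict Implicit.

Import Order.LTheory Order.CTheory.
Local Open Scope classical_set_scope.
Local Open Scope card_scope.

(** A complete Boolean algebra is determined by any dense subalgebra, and for a Boolean algebra [A]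
    the regular closed sets of its Stone space form the completion of [A]. Hence it suffices to find
    a dense subalgebra of [RC X] of size at most the pi-weight: [generated_subalgebra] bounds the
    size, [rc_below_mono] and [rc_below_surj] identify the completion, and [pi_weight_le_weight]
    shows that the weight of the Stone space cannot drop below the pi-weight. *)

(** * Cardinal arithmetic: an infinite set absorbs its square *)

Lemma card_le_total T (A B : set T) : A #<= B \/ B #<= A.
Proof.
have [|C [[->|->] leC]] := @least_card_exists T [set A; B].
- by exists A; left.
- by left; apply: leC; right.
- by right; apply: leC; left.
Qed.

(** An injection of the square of [S] into [S]. Keeping [g] total on [T] lets Zorn's lemma compare
    different [S]; values off [S] do not matter. *)
Definition squaring T (S : set T) (g : T -> T -> T) :=
  (forall x y, S x -> S y -> S (g x y)) /\
  (forall x y x' y', S x -> S y -> S x' -> S y' ->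
     g x y = g x' y' -> x = x' /\ y = y').

Lemma squaring_range T (i : nat -> T) :
  injective i -> exists g, squaring (range i) g.
Proof.
move=> i_inj.
have /choice[k kP] : forall x, exists n, range i x -> i n = x.
  move=> x; have [[n _ <-]|nx] := pselect (range i x); first by exists n.
  by exists 0%N.
exists (fun x y => i (pickle (k x, k y))); split=> [x y _ _|].
  by exists (pickle (k x, k y)).
move=> x y x' y' Sx Sy Sx' Sy' /i_inj /(pcan_inj pickleK)[ex ey].
by rewrite -(kP _ Sx) -(kP _ Sy) ex ey !kP.
Qed.

(** Two members agree where both are defined, since a third extends both, so the maps glue. Any four
    points of the union lie in one member, which gives injectivity. *)
Lemma squaring_chain T (F : set (set T * (T -> T -> T))) :
  (forall p, F p -> squaring p.1 p.2) ->
  (forall p q, F p -> F q -> exists r, [/\ F r, p.1 `<=` r.1, q.1 `<=` r.1,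
     forall x y, p.1 x -> p.1 y -> r.2 x y = p.2 x y &
     forall x y, q.1 x -> q.1 y -> r.2 x y = q.2 x y]) ->
  exists g, squaring (\bigcup_(p in F) p.1) g /\
    forall p x y, F p -> p.1 x -> p.1 y -> g x y = p.2 x y.
Proof.
move=> Fsq Fdir.
have /choice[g gP] : forall xy : T * T, exists v,
    forall p, F p -> p.1 xy.1 -> p.1 xy.2 -> p.2 xy.1 xy.2 = v.
  move=> [x y] /=; have [[p [Fp px py]]|nP] :=
      pselect (exists p, [/\ F p, p.1 x & p.1 y]); last first.
    by exists x => p Fp px py; case: nP; exists p.
  exists (p.2 x y) => q Fq qx qy; have [r [_ _ _ rp rq]] := Fdir _ _ Fp Fq.
  by rewrite -rp// -rq.
have gE p x y : F p -> p.1 x -> p.1 y -> g (x, y) = p.2 x y.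
  by move=> Fp px py; rewrite -(gP (x, y) p).
exists (fun x y => g (x, y)); split; last exact: gE.
split=> [x y [p Fp px] [q Fq qy]|].
  have [r [Fr pr qr _ _]] := Fdir _ _ Fp Fq.
  by exists r => //; rewrite (gE r); [apply: (Fsq _ Fr).1| | |]; auto.
move=> x y x' y' [p Fp px] [q Fq qy] [p' Fp' px'] [q' Fq' qy'].
have [r [Fr pr qr _ _]] := Fdir _ _ Fp Fq.
have [r' [Fr' pr' qr' _ _]] := Fdir _ _ Fp' Fq'.
have [s [Fs rs r's _ _]] := Fdir _ _ Fr Fr'.
rewrite !(gE s); auto.
by apply: (Fsq _ Fs).2; auto.
Qed.

(** The new pairs split into three blocks, according to which coordinates lie in [S]. Each block is
    folded back to [S] by the retraction [r], coded by [g] with its own tag [a], [b] or [c], and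
    sent into the fresh copy by [h]. *)
Lemma squaring_extend T (S : set T) (g : T -> T -> T) (h : T -> T) (a b c : T) :
  squaring S g -> S a -> S b -> S c -> a <> b -> a <> c -> b <> c ->
  (forall x, S x -> ~ S (h x)) -> {in S &, injective h} ->
  exists g', squaring (S `|` h @` S) g' /\
    forall x y, S x -> S y -> g' x y = g x y.
Proof.
move=> [gS ginj] Sa Sb Sc ab ac bc hS hinj.
have /choice[r rP] : forall x, exists y,
    (S x -> y = x) /\ ((h @` S) x -> S y /\ h y = x).
  move=> x; have [Sx|nSx] := pselect (S x).
    by exists x; split=> // -[y Sy hy]; case: (hS _ Sy); rewrite hy.
  have [[y Sy <-]|nx] := pselect ((h @` S) x); last by exists x.
  by exists y; split=> [/(hS _ Sy)|].
have rS x : (S `|` h @` S) x -> S (r x).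
  by have [rx rx'] := rP x; move=> [Sx|/rx'[]//]; rewrite rx.
pose t x y := if x \in S then a else if y \in S then b else c.
have St x y : S (t x y) by rewrite /t; case: ifP => // _; case: ifP.
exists (fun x y => if (x \in S) && (y \in S) then g x y
                   else h (g (t x y) (g (r x) (r y)))).
split; last by move=> x y Sx Sy; rewrite !mem_set.
split=> [x y /rS Sx /rS Sy|x y x' y' Ux Uy Ux' Uy'].
  case: ifP => [/andP[/set_mem Sx' /set_mem Sy']|_]; first by left; exact: gS.
  by right; exists (g (t x y) (g (r x) (r y))); auto.
have r_inj z z' : (S `|` h @` S) z -> (S `|` h @` S) z' ->
    (z \in S) = (z' \in S) -> r z = r z' -> z = z'.
  have [rz1 rz2] := rP z; have [rz'1 rz'2] := rP z'.
  move=> Uz Uz'; case: (boolP (z' \in S)) => [/set_mem Sz' /set_mem Sz|nz' nz].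
    by rewrite rz1// rz'1.
  move: Uz Uz' => [/mem_set|/rz2[_ {2}<-]]; first by rewrite nz.
  by move=> [/mem_set|/rz'2[_ {2}<-] ->//]; rewrite (negbTE nz').
(* Codes of old pairs lie in [S], codes of new pairs outside it, so they never collide. *)
have key u v : S u -> S v -> g u v <> h (g (t x' y') (g (r x') (r y'))).
  by move=> Su Sv e; apply: (hS (g (t x' y') (g (r x') (r y'))));
    rewrite -?e; auto.
have key' u v : S u -> S v -> h (g (t x y) (g (r x) (r y))) <> g u v.
  by move=> Su Sv e; apply: (hS (g (t x y) (g (r x) (r y)))); rewrite ?e; auto.
case: ifP => [/andP[/set_mem Sx /set_mem Sy]|nxy];
    case: ifP => [/andP[/set_mem Sx' /set_mem Sy']|nxy'].
- exact: ginj.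
- by move/key; case.
- by move/key'; case.
move: (rS _ Ux) (rS _ Uy) (rS _ Ux') (rS _ Uy') => Srx Sry Srx' Sry'.
move/hinj; rewrite !mem_set; auto => /(_ erefl erefl)/ginj[]; auto.
move=> et /ginj[]; auto => ex ey.
(* Both pairs are new, so equal tags mean the same block; within a block [r] is injective in each
   coordinate. *)
have [exS eyS] : (x \in S) = (x' \in S) /\ (y \in S) = (y' \in S).
  move: et nxy nxy'; rewrite /t.
  by do 4!case: (_ \in S) => //=; try done; try (by move/esym).
by split; apply: r_inj.
Qed.

(* Zorn gives a maximal S with an injection S * S -> S. If S embedded in its  *)
(* complement, it could be extended by a copy of itself; otherwise the        *)
(* complement embeds in S, hence T injects into S * 2, hence into S.          *)
Lemma infinite_prod_inj (T : Type) : [set: nat] #<= [set: T] ->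
  exists p : T * T -> T, injective p.
Proof.
elim/Ppointed : T => T; first by rewrite emptyE => /eqP/seteqP[/(_ 0%N I)].
move=> /pcard_injP[i' i'inj]; have i_inj : injective i'.
  by move=> m n; apply: i'inj; rewrite inE.
move: i' i_inj {i'inj} => i i_inj.
have [g0 g0P] := @squaring_range T i i_inj.
(* Requiring [range i] inside the set guarantees the distinct tags [i 0], [i 1], [i 2] in the
   maximal one. *)
pose P (p : set T * (T -> T -> T)) := range i `<=` p.1 /\ squaring p.1 p.2.
pose Q := {p | P p}.
pose R (p q : Q) := `[< (sval p).1 `<=` (sval q).1 /\
  forall x y, (sval p).1 x -> (sval p).1 y -> (sval q).2 x y = (sval p).2 x y >].
have p0P : P (range i, g0).
  by split.
have [] := @ZL_preorder Q (exist P _ p0P) R.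
- by move=> p; apply/asboolP; split.
- move=> q p r /asboolP[pq epq] /asboolP[qr eqr]; apply/asboolP.
  by split; [exact: subset_trans qr|
             move=> x y px py; rewrite eqr ?epq//; exact: pq].
- move=> C Ctot; have [[q Cq]|C0] := pselect (C !=set0); last first.
    by exists (exist P _ p0P) => p Cp; case: C0; exists p.
  have [||g [gsq gE]] := @squaring_chain T (sval @` C).
  + by move=> _ [p _ <-]; case: (svalP p).
  + move=> _ _ [p1 Cp1 <-] [p2 Cp2 <-].
    have [/asboolP[s12 e12]|/asboolP[s21 e21]] := Ctot _ _ Cp1 Cp2.
      by exists (sval p2); split=> //; exists p2.
    by exists (sval p1); split=> //; exists p1.
  have UP : P (\bigcup_(p in sval @` C) p.1, g).
    split=> // x ix; exists (sval q); first by exists q.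
    by have [+ _] := svalP q; apply.
  exists (exist P _ UP) => p Cp; apply/asboolP; split=> /=.
    by move=> x px; exists (sval p) => //; exists p.
  by move=> x y px py; rewrite (gE (sval p))//; exists p.
move=> [[S g] iSg] Smax; have [/= iS gsq] := iSg.
have [gS ginj] := gsq.
have Si n : S (i n) by apply: iS; exists n.
have ineq m n : m != n -> i m <> i n by move=> /eqP mn /i_inj.
have [] := @card_le_total T S (~` S).
- move=> /pcard_leP[h].
  have [||g' [g'sq g'E]] := @squaring_extend T S g h (i 0%N) (i 1%N) (i 2%N) gsq
    (Si _) (Si _) (Si _) (ineq 0 1 isT)%N (ineq 0 2 isT)%N (ineq 1 2 isT)%N.
  + by move=> x Sx; exact: (@funS _ _ _ _ h x Sx).
  + exact: inj.
  have UP : P (S `|` h @` S, g').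
    by split=> // x ix; left; exact: iS.
  have /Smax /asboolP[/= + _] : R (exist P (S, g) iSg) (exist P _ UP).
    by apply/asboolP; split=> //= x; left.
  move=> /(_ (h (i 0%N))) Shi.
  have : (~` S) (h (i 0%N)) by exact: (@funS _ _ _ _ h).
  by case; apply: Shi; right; exists (i 0%N).
- move=> /pcard_leP[k].
  have kS x : ~ S x -> S (k x) by exact: (@funS _ _ _ _ k).
  pose j x := if x \in S then g (i 0%N) x else g (i 1%N) (k x).
  have jS x : S (j x).
    by rewrite /j; case: (boolP (x \in S)) => [/set_mem xS|/negP xS];
      apply: gS => //; apply: kS => /mem_set.
  have jinj : injective j.
    move=> x y; rewrite /j.
    case: (boolP (x \in S)) => [/set_mem Sx|/negP nx];
      case: (boolP (y \in S)) => [/set_mem Sy|/negP ny].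
    + by move=> /ginj[].
    + have Sy : ~ S y by move/mem_set.
      by move=> /ginj[]//; [exact: kS|move/i_inj].
    + have Sx : ~ S x by move/mem_set.
      by move=> /ginj[]//; [exact: kS|move/i_inj].
    + have [Sx Sy] : ~ S x /\ ~ S y by split=> /mem_set.
      move=> /ginj[]//; try exact: kS.
      by move=> _; apply: (@inj _ _ _ k); rewrite inE.
  exists (fun xy => g (j xy.1) (j xy.2)) => -[x y] [x' y'] /= /ginj[]//.
  by move=> /jinj -> /jinj ->.
Qed.

(** * Subalgebras generated by an infinite family *)

(** Since triples from [T] are coded by single elements of [T], every stage of the closure is again
    a family indexed by [T]. The union of the stages is an image of [nat * T], which injects into
    [T]. *)
Lemma generated_subalgebra d (L : ctbDistrLatticeType d) (T : Type)
    (b : T -> L) : [set: nat] #<= [set: T] ->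
  exists A : set L, [/\ A #<= [set: T], forall t, A (b t), A \top%O,
    forall x y, A x -> A y -> A (x `&` y)%O & forall x, A x -> A (~` x)%O].
Proof.
move=> infT; have [p pinj] := infinite_prod_inj infT.
have [i iinj] : exists i : nat -> T, injective i.
  elim/Ppointed: T => T in b infT p pinj *; first by
    move: infT; rewrite emptyE => /eqP/seteqP[/(_ 0%N I)].
  by move/pcard_injP: infT => [i iinj]; exists i => m n;
    apply: iinj; rewrite inE.
have /choice[q qP] : forall t, exists xy, forall xy', p xy' = t -> xy = xy'.
  move=> t; have [[xy <-]|np] := pselect (exists xy, p xy = t).
    by exists xy => xy' /pinj.
  by exists (t, t) => xy' e; case: np; exists xy'.
have pK xy : q (p xy) = xy by apply: qP.
(* Nand alone generates; the tag i 0 makes each level contain the previous.  *)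
pose step (e : T -> L) t := let: (u, vw) := q t in let: (v, w) := q vw in
  if `[< u = i 0%N >] then e v else (~` (e v `&` e w))%O.
pose e n := iter n step b.
pose A := [set e nt.1 nt.2 | nt in [set: nat * T]].
have stepl f v : step f (p (i 0%N, p (v, v))) = f v.
  by rewrite /step !pK; case: asboolP.
have stepr f v w : step f (p (i 1%N, p (v, w))) = (~` (f v `&` f w))%O.
  by rewrite /step !pK; case: asboolP => // /iinj.
have e_le m n t : (m <= n)%N -> exists t', e n t' = e m t.
  elim: n => [|n IH]; first by rewrite leqn0 => /eqP ->; exists t.
  rewrite leq_eqVlt => /predU1P[->|/IH[t' et']]; first by exists t.
  by exists (p (i 0%N, p (t', t'))); rewrite -et' /= stepl.
have Anand x y : A x -> A y -> A (~` (x `&` y))%O.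
  move=> [[m t] _ <-] [[n t'] _ <-] /=.
  have [u <-] := e_le _ _ t (leq_maxl m n).
  have [v <-] := e_le _ _ t' (leq_maxr m n).
  by exists ((maxn m n).+1, p (i 1%N, p (u, v))) => //=; rewrite stepr.
have AC x : A x -> A (~` x)%O by move=> Ax; rewrite -[x]meetxx; exact: Anand.
have AI x y : A x -> A y -> A (x `&` y)%O.
  by move=> Ax Ay; rewrite -[X in A X]complK; apply/AC/Anand.
have Ab t : A (b t) by exists (0%N, t).
exists A; split=> //.
- apply: (card_le_trans (card_image_le _ _)).
  have /injfunPex[h] : exists2 h : nat * T -> T,
      set_fun [set: nat * T] [set: T] h & set_inj [set: nat * T] h.
    exists (fun nt => p (i nt.1, nt.2)) => // -[n t] [n' t'] _ _ /=.
    by move=> /pinj[/iinj -> ->].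
  exact: inj_card_le h.
- have := AC _ (AI _ _ (Ab (i 0%N)) (AC _ (Ab (i 0%N)))).
  by rewrite meetxC compl0.
Qed.

(** * The Stone space of a subalgebra *)

Section stone_space.
Context {d : Order.disp_t} {L : ctbDistrLatticeType d}.
Variable A : set L.
Implicit Types (a b x : L).

(** Ultrafilters of [A], kept as subsets of [L] so that [A] need not be made a Boolean algebra type
    of its own. *)
Record ultra_on (y : set L) : Prop := UltraOn {
  ultra_sub : y `<=` A;
  ultra_top : y \top%O;
  ultra_bot : ~ y \bot%O;
  ultra_meet : forall a b, y a -> y b -> y (a `&` b)%O;
  ultra_up : forall a b, y a -> A b -> (a <= b)%O -> y b;
  ultra_compl : forall a, A a -> y a \/ y (~` a)%O }.

Record stone := Stone { stone_set :> set L; stoneP : ultra_on stone_set }.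

HB.instance Definition _ := gen_eqMixin stone.
HB.instance Definition _ := gen_choiceMixin stone.

Implicit Types y : stone.

Definition cell a : set stone := [set y : stone | stone_set y a].

Definition stone_open (U : set stone) :=
  forall y, U y -> exists2 a, stone_set y a & cell a `<=` U.

Lemma cellI a b : cell a `&` cell b `<=` cell (a `&` b)%O.
Proof. by move=> y [ya yb]; apply: ultra_meet => //; exact: stoneP. Qed.

Lemma stone_openT : stone_open setT.
Proof. by move=> y _; exists \top%O => //; exact: ultra_top (stoneP y). Qed.

Lemma cell_sub a b : A b -> (a <= b)%O -> cell a `<=` cell b.
Proof. by move=> Ab ab y ya; exact: (ultra_up (stoneP y) ya Ab ab). Qed.

Lemma stone_openI : setI_closed stone_open.
Proof.
move=> U V oU oV y [/oU[a ya aU] /oV[b yb bV]].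
have [Aa Ab] := (ultra_sub (stoneP y) ya, ultra_sub (stoneP y) yb).
exists (a `&` b)%O; first exact: (@cellI a b).
by move=> z zab; split; [apply: aU|apply: bV];
  apply: (ultra_up (stoneP z) zab); rewrite ?leIl ?leIr.
Qed.

Lemma stone_open_bigU (I : Type) (f : I -> set stone) :
  (forall i, stone_open (f i)) -> stone_open (\bigcup_i f i).
Proof.
move=> of_ y [i _ /of_[a ya af]]; exists a => //.
by move=> z /af fz; exists i.
Qed.

HB.instance Definition _ :=
  isOpenTopological.Build stone stone_openT stone_openI stone_open_bigU.

Lemma open_stoneE : open = stone_open.
Proof. by []. Qed.

Lemma open_cell a : open (cell a).
Proof. by rewrite open_stoneE => y ya; exists a. Qed.

Lemma cell_compl a : A a -> ~` cell a = cell (~` a)%O.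
Proof.
move=> Aa; apply/seteqP; split=> y.
  by have [] := ultra_compl (stoneP y) Aa.
move=> yNa ya; apply: (ultra_bot (stoneP y)).
by rewrite -(meetxC a); exact: (ultra_meet (stoneP y) ya yNa).
Qed.

Lemma clopen_cell a : A a -> clopen (cell a).
Proof.
move=> Aa; split; first exact: open_cell.
by rewrite -openC cell_compl//; exact: open_cell.
Qed.

Lemma basis_cell : basis (cell @` A).
Proof.
split=> [_ [a _ <-]|y U]; first exact: open_cell.
rewrite nbhsE => -[V [oV Vy] VU].
have [a ya aV] : exists2 a, stone_set y a & cell a `<=` V.
  by move: oV; rewrite open_stoneE; apply.
exists (cell a); last exact: subset_trans VU.
by split=> //; exists a => //; exact: (ultra_sub (stoneP y) ya).
Qed.

Lemma stone_has_clopen_base : has_clopen_base stone.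
Proof.
exists (cell @` A); first exact: basis_cell.
by move=> _ [a Aa <-]; exact: clopen_cell.
Qed.

(** Ultrafilters are maximal: an [a] in [z] but not in [y] would put its complement in [y], hence in
    [z]. *)
Lemma stone_inj y (z : stone) : stone_set y `<=` stone_set z -> y = z.
Proof.
move=> yz; have zy : stone_set z `<=` stone_set y.
  move=> a za; have Aa := ultra_sub (stoneP z) za.
  have [//|/yz zNa] := ultra_compl (stoneP y) Aa.
  case: (ultra_bot (stoneP z)); rewrite -(meetxC a).
  exact: (ultra_meet (stoneP z) za zNa).
case: y z {yz zy}(conj yz zy) => [y yP] [z zP] /= /seteqP e.
by move: yP zP; rewrite e => yP zP; rewrite (Prop_irrelevance yP zP).
Qed.

Lemma stone_hausdorff : hausdorff_space stone.
Proof.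
rewrite open_hausdorff => y z /eqP yz.
have [a [ya nza]] : exists a, stone_set y a /\ ~ stone_set z a.
  apply: contrapT => nex; apply/yz/stone_inj => a ya.
  by apply: contrapT => nza; apply: nex; exists a.
have Aa := ultra_sub (stoneP y) ya.
exists (cell a, cell (~` a)%O) => /=.
  by rewrite !mem_set// -cell_compl.
split; [exact: open_cell|exact: open_cell|].
by rewrite -cell_compl// setICr.
Qed.

(** An ultrafilter [F] on the space converges to the point formed by those [a] in [A] whose cell
    belongs to [F]. *)
Lemma stone_compact : A \top%O -> (forall a b, A a -> A b -> A (a `&` b)%O) ->
  (forall a, A a -> A (~` a)%O) -> compact [set: stone].
Proof.
move=> A1 AI AC; rewrite compact_ultra => F FU _.
have yP : ultra_on [set a | A a /\ F (cell a)].
  split=> [a []//||[_]|a b [Aa Fa] [Ab Fb]|a b [Aa Fa] Ab ab|a Aa].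
  - split=> //; apply: filterS filterT => y _; exact: ultra_top (stoneP y).
  - by move/filter_ex => [y /(ultra_bot (stoneP y))].
  - by split; [exact: AI|apply: filterS (filterI Fa Fb); exact: cellI].
  - by split=> //; apply: filterS Fa; exact: cell_sub.
  - have [Fa|Fa] := in_ultra_setVsetC (cell a) FU; first by left.
    by right; split; [exact: AC|rewrite -cell_compl].
exists (Stone yP); split=> // U; rewrite nbhsE => -[V [oV Vy] VU].
have [a [Aa Fa] aV] : exists2 a, stone_set (Stone yP) a & cell a `<=` V.
  by move: oV; rewrite open_stoneE; apply.
by apply: filterS Fa; exact: subset_trans VU.
Qed.

(* The point is the trace on A of an ultrafilter of subsets of L containing   *)
(* all D such that, densely below a, the nonzero lower sets lie in D; such D  *)
(* decide b against its complement for every b.                               *)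
Lemma cell_nonempty a : A \top%O -> (forall a b, A a -> A b -> A (a `&` b)%O) ->
  (forall a, A a -> A (~` a)%O) -> A a -> a != \bot%O -> cell a !=set0.
Proof.
move=> A1 AI AC Aa a0.
pose D := [set S : set L | forall x, x != \bot%O -> (x <= a)%O ->
  exists z, [/\ z != \bot%O, (z <= x)%O &
    forall w, w != \bot%O -> (w <= z)%O -> S w]].
have DF : ProperFilter D.
  apply: Build_ProperFilter_ex => [S /(_ a a0 (lexx _))[z [z0 _ /(_ z z0 (lexx _))]]|].
    by exists z.
  split=> [x x0 _|S S' DS DS' x x0 xa|S S' SS' DS x x0 xa]; first by exists x.
  - have [z [z0 zx zS]] := DS x x0 xa.
    have [z' [z'0 z'z z'S']] := DS' z z0 (le_trans zx xa).
    exists z'; split=> //; first exact: le_trans zx.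
    by move=> w w0 wz'; split; [apply: zS => //; exact: le_trans z'z|exact: z'S'].
  - by have [z [z0 zx zS]] := DS x x0 xa; exists z; split=> // w w0 /zS/SS'; apply.
have [U [UU DU]] := ultraFilterLemma DF.
have yP : ultra_on [set b | A b /\ U [set w | w <= b]%O].
  split=> [b []//||[_ Ub]|b c [Ab Ub] [Ac Uc]|b c [Ab Ub] Ac bc|b Ab].
  - by split=> //; apply: filterS filterT => w _; exact: lex1.
  (* The lower set of the bottom is the bottom alone, and [U] contains its complement. *)
  - have Un0 : U [set w | w != \bot%O] by apply: DU => x x0 _; exists x.
    have [w [/= + /eqP]] := filter_ex (filterI Ub Un0).
    by rewrite lex0 => /eqP.
  - split; first exact: AI.
    by apply: filterS (filterI Ub Uc) => w [/= wb wc]; rewrite lexI wb.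
  - by split=> //; apply: filterS Ub => w /= /le_trans; apply.
  - have Ubb : U ([set w | w <= b]%O `|` [set w | w <= ~` b]%O).
      apply: DU => x x0 _; have [xb|xb] := eqVneq (x `&` b)%O \bot%O.
        exists x; split=> // w _ wx; right; apply: (le_trans wx).
        by rewrite -disj_leC xb.
      exists (x `&` b)%O; split=> //; first exact: leIl.
      by move=> w _; rewrite lexI => /andP[_ ?]; left.
    have [Ub|Ub] := in_ultra_setVsetC [set w | w <= b]%O UU; first by left.
    right; split; first exact: AC.
    by apply: filterS (filterI Ub Ubb) => w [/= ? []].
exists (Stone yP); split=> //; apply: DU => x x0 xa.
exists x; split=> // w _ wx.
exact: le_trans wx xa.
Qed.

End stone_space.

Arguments cell {d L} A a.

(** * The Stone space of a dense subalgebra realises the completion *)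

(** All Boolean operations are determined by the order, so a surjective order embedding preserves
    them. *)
Lemma order_iso_boolean d d' (L : ctbDistrLatticeType d)
    (M : ctbDistrLatticeType d') (f : L -> M) :
  {mono f : x y / (x <= y)%O} -> (forall z, exists x, f x = z) ->
  boolean_isomorphic L M.
Proof.
move=> fle /choice[g gK]; have fK : cancel f g.
  by move=> x; apply/le_anti; rewrite -!fle gK lexx.
have leP z x : (z <= f x)%O = (g z <= x)%O by rewrite -fle gK.
have geP z x : (f x <= z)%O = (x <= g z)%O by rewrite -fle gK.
have f0 : f \bot%O = \bot%O by apply/le_anti; rewrite geP !le0x.
have f1 : f \top%O = \top%O by apply/le_anti; rewrite leP !lex1.
have fI : {morph f : x y / (x `&` y)%O}.
  move=> x y; apply/le_anti/andP; split; first by rewrite lexI !fle leIl leIr.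
  by rewrite leP lexI -!leP leIl leIr.
have fU : {morph f : x y / (x `|` y)%O}.
  move=> x y; apply/le_anti/andP; split; last by rewrite leUx !fle leUl leUr.
  by rewrite geP leUx -!geP leUl leUr.
exists f; first by exists g.
split=> // x; apply/le_anti/andP; split.
  by rewrite -disj_leC -fI meetC meetxC f0.
rewrite -[X in (X <= _)%O]meetx1 -f1 -(joinxC x) fU meetUr.
by rewrite [X in (X `|` _)%O]meetC meetxC join0x leIr.
Qed.

Section completion.
Context {d : Order.disp_t} {L : ctbDistrLatticeType d} {A : set L}.
Hypothesis A1 : A \top%O.
Hypothesis AI : forall a b, A a -> A b -> A (a `&` b)%O.
Hypothesis AC : forall a, A a -> A (~` a)%O.
Hypothesis Adense : forall x : L, x != \bot%O ->
  exists a, [/\ A a, a != \bot%O & (a <= x)%O].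

Let cellP a : A a -> a != \bot%O -> cell A a !=set0 :=
  @cell_nonempty _ _ A a A1 AI AC.

Definition cells_below (x : L) : set (stone A) :=
  \bigcup_(a in [set a | A a /\ (a <= x)%O]) cell A a.

Lemma open_cells_below x : open (cells_below x).
Proof. by apply: bigcup_open => a _; exact: open_cell. Qed.

Definition rc_below (x : L) : RC (stone A) :=
  rc_of (closure_open_regclosed (@open_cells_below x)).

(** If [x] is not below [y], density gives a nonzero [a] in [A] below [x] and disjoint from [y]. Its
    cell is nonempty and open, lies in the image of [x], and misses every cell below [y], hence also
    the closure of their union. *)
Lemma rc_below_mono : {mono rc_below : x y / (x <= y)%O}.
Proof.
move=> x y; apply/idP/idP => [/rc_leP xy|xy]; last first.
  apply/rc_leP; apply: closureS => z [a [Aa ax] za]; exists a => //.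
  by split=> //; exact: le_trans xy.
rewrite -[y]complK -disj_leC; apply/negP => /negP /Adense[a [Aa a0 axy]].
have [z za] := cellP Aa a0; move: axy; rewrite lexI => /andP[ax ay].
have /xy /(_ (cell A a)) [] : rc_set (rc_below x) z.
- by apply: subset_closure; exists a.
- by apply: open_nbhs_nbhs; split=> //; exact: open_cell.
move=> z' [[b [Ab yb] z'b] z'a]; apply: (ultra_bot (stoneP z')).
suff <- : (a `&` b)%O = \bot%O by exact: cellI.
apply/eqP; rewrite disj_leC; apply: (le_trans ay).
by rewrite leC.
Qed.

(** The preimage of [C] is the supremum [x] of all [a] in [A] with cell inside [C]. No further cell
    appears below [x]: if [cell b] misses [C], the complement of [b] bounds all these [a], so [x] is
    disjoint from [b]. *)
Lemma rc_below_surj :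
  (forall S : set L, exists s, forall u, (s <= u)%O <-> ubound S u) ->
  forall C : RC (stone A), exists x, rc_below x = C.
Proof.
move=> Lcomplete C; have [x xP] := Lcomplete [set a | A a /\ cell A a `<=` C].
exists x; apply/le_anti/andP; split; apply/rc_leP.
  rewrite [X in _ `<=` X](closure_id _).1; last exact: rc_closed.
  apply: closureS => y [a [Aa ax] ya].
  apply: contrapT => nCy.
  have : open (~` (C : set (stone A))) by rewrite openC; exact: rc_closed.
  rewrite open_stoneE => /(_ y nCy) [b yb bC].
  have Ab := ultra_sub (stoneP y) yb.
  have /(le_trans ax) : (x <= ~` b)%O.
    apply/xP => c [Ac cC]; rewrite -disj_leC; apply/negPn/negP => cb0.
    have [z zcb] := cellP (AI Ac Ab) cb0.
    apply: (bC z); first by apply: (cell_sub Ab _ zcb); exact: leIr.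
    by apply: cC; apply: (cell_sub Ac _ zcb); exact: leIl.
  rewrite -disj_leC => /eqP ab0; apply: (ultra_bot (stoneP y)).
  by rewrite -ab0; exact: (ultra_meet (stoneP y) ya yb).
rewrite -[X in X `<=` _](rcP C); apply: closureS => y.
have : open (C : set (stone A))° by exact: open_interior.
rewrite open_stoneE => /[apply] -[a ya aC]; exists a => //; split.
  exact: (ultra_sub (stoneP y) ya).
have [+ _] := xP x; apply; first exact: lexx.
split; first exact: (ultra_sub (stoneP y) ya).
exact: subset_trans aC (@interior_subset _ _).
Qed.

End completion.

(** * Regular closed sets, pi-bases and the two weights *)

Section regular_closed.
Context {X : topologicalType}.
Implicit Types (F G : RC X) (U V : set X).

Definition rcl (V : set X) : RC X := rc_of (regclosed_closure_interior V).

Lemma rcl_subset F V : V `<=` F -> (rcl V <= F)%O.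
Proof.
move=> VF; apply/rc_leP; apply: regclosed_closure_interior_sub => //.
exact: rc_closed.
Qed.

Lemma rcl_neq0 V : open V -> V !=set0 -> rcl V != \bot%O.
Proof.
move=> oV [x Vx]; apply/eqP => /(congr1 (@rc_set X)) /= /seteqP[/(_ x) + _].
by apply; apply: subset_closure; rewrite (interior_id _).1.
Qed.

Lemma rc_interior_neq0 F : F != \bot%O -> ((F : set X)°) !=set0.
Proof.
move=> F0; apply/set0P; apply: contra F0 => /eqP F0.
by apply/eqP/rc_inj; rewrite -(rcP F) F0 closure0.
Qed.

Lemma rc_complete (S : set (RC X)) :
  exists F, forall G, (F <= G)%O <-> ubound S G.
Proof.
exists (rcl (\bigcup_(F in S) F)) => G; split=> [FG F SF|SG].
  apply: le_trans FG; apply/rc_leP; rewrite -(rcP F); apply: closureS.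
  by apply: interiorS => x Fx; exists F.
by apply: rcl_subset => x [F /SG/rc_leP FG /FG].
Qed.

End regular_closed.

(** A base of [Y] is pulled back through the isomorphism: each basic [V] becomes the interior of the
    regular closed set of [X] matching [rcl V]. These interiors form a pi-base of [X]. *)
Lemma pi_weight_le_weight (X Y : topologicalType) :
  pi_semiregular X -> boolean_isomorphic (RC X) (RC Y) ->
  pi_weight X #<= weight Y.
Proof.
move=> [_ Xreg] [f [g fK gK] [f0 _ fI _ _]].
have [[Bopen Bnbhs] _] := weightP Y.
have [_ pi_least] := pi_weightP X.
pose h (V : set Y) := (g (rcl V) : set X)°.
apply: card_le_trans (card_image_le h (weight Y)); apply: pi_least.
split=> [_ [V _ <-]|U oU U0]; first exact: open_interior.
have [W [rW [x Wx] WU]] := Xreg U oU U0.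
have rC : regclosed (closure W).
  by apply: closure_open_regclosed; rewrite -rW; exact: open_interior.
have fC0 : f (rc_of rC) != \bot%O.
  rewrite -f0 (can_eq fK); apply/eqP => /(congr1 (@rc_set X)) /= /seteqP[/(_ x) + _].
  by apply; exact: subset_closure.
have [y fCy] := rc_interior_neq0 fC0.
have [|V [BV Vy] VfC] := Bnbhs y (f (rc_of rC) : set Y)°.
  by apply: open_nbhs_nbhs; split=> //; exact: open_interior.
have V0 : rcl V != \bot%O by apply: rcl_neq0; [exact: Bopen|exists y].
exists (h V); split; first by exists V.
  apply: rc_interior_neq0; apply: contra_neq V0 => e.
  by rewrite -(gK (rcl V)) e f0.
(* The pulled-back set is only known to lie in the closure of [W]; as [W] is regular open, its
   interior lies in [W]. This is the use of pi-semiregularity. *)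
apply: subset_trans WU; rewrite -rW; apply: interiorS.
apply/(@rc_leP _ _ (rc_of rC)).
have /meet_idPl e : (rcl V <= f (rc_of rC))%O.
  by apply: rcl_subset; exact: subset_trans VfC (@interior_subset _ _).
by apply/meet_idPl; rewrite -[LHS]fK fI gK e.
Qed.

Theorem proposition5p2 (X : topologicalType)
    (hX : pi_semiregular X) (hpw : [set: nat] #<= pi_weight X) :
  exists Y : topologicalType,
    [/\ compact [set: Y], hausdorff_space Y, has_clopen_base Y,
        weight Y #= pi_weight X & boolean_isomorphic (RC X) (RC Y)].
Proof.
have [[pi_open pi_dense] _] := pi_weightP X.
have [|A [leA Arcl A1 AI AC]] :=
    @generated_subalgebra _ (RC X) (pi_weight X) (fun V => rcl (val V)).
  by rewrite (card_le_eqr (card_setT _)).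
have Adense (F : RC X) : F != \bot%O ->
    exists a, [/\ A a, a != \bot%O & (a <= F)%O].
  move=> /rc_interior_neq0 F0.
  have [V [piV V0 VF]] := pi_dense _ (open_interior _) F0.
  exists (rcl V); split; first exact: (Arcl (SigSub (mem_set piV))).
    exact: rcl_neq0 (pi_open _ piV) V0.
  by apply: rcl_subset; exact: subset_trans VF (@interior_subset _ _).
have iso : boolean_isomorphic (RC X) (RC (stone A)).
  apply: order_iso_boolean (rc_below_mono A1 AI AC Adense) _.
  exact: rc_below_surj rc_complete.
exists (stone A); split=> //.
- exact: stone_compact.
- exact: stone_hausdorff.
- exact: stone_has_clopen_base.
(* The remaining bound holds because the cells of [A] form a base and [A] is no larger than
   [pi_weight X]. *)
apply: Cantor_Bernstein; last exact: pi_weight_le_weight.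
rewrite -(card_le_eqr (card_setT _)); apply: card_le_trans leA.
apply: card_le_trans (card_image_le (cell A) A).
by have [_] := weightP (stone A); apply; exact: basis_cell.
Qed.
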